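(* Let $k$ be an algebraically closed field of characteristic zero, and let $P:k^2\to k$ be a polynomial such that the set $\{(P(a,c),P(a,d),P(b,c),P(b,d)): a,b,c,d\in k\}$ is not Zariski dense in $k^4$. Then one of the following holds: (i) (Additive structure) there exist polynomials $Q,F,G:k\to k$ such that $P(x,y)=Q(F(x)+G(y))$ for all $x,y\in k$; (ii) (Multiplicative structure) there exist polynomials $Q,F,G:k\to k$ such that $P(x,y)=Q(F(x)G(y))$ for all $x,y\in k$. *)

(* Defs.v *)
From mathcomp Require Import all_boot all_order all_algebra.
From mathcomp Require Import mpoly.

Set Implicit Arguments.
Unset Strict Implicit.
Unset Printing Implicit Defensive.

Import GRing.Theory.
Local Open Scope ring_scope.

(* Points of the affine space k^n are n-tuples. *)
Definition zero_locus (k : fieldType) (n : nat) (I : {mpoly k[n]} -> Prop)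
    (v : n.-tuple k) : Prop :=
  forall p : {mpoly k[n]}, I p -> p.@[tnth v] = 0.

Definition zariski_closed (k : fieldType) (n : nat)
    (Z : n.-tuple k -> Prop) : Prop :=
  exists I : {mpoly k[n]} -> Prop, forall v, Z v <-> zero_locus I v.

Definition zariski_closure (k : fieldType) (n : nat)
    (S : n.-tuple k -> Prop) (v : n.-tuple k) : Prop :=
  forall Z : n.-tuple k -> Prop,
    zariski_closed Z -> (forall w, S w -> Z w) -> Z v.

Definition zariski_dense (k : fieldType) (n : nat)
    (S : n.-tuple k -> Prop) : Prop :=
  forall v, zariski_closure S v.

Definition eval2 (k : fieldType) (P : {mpoly k[2]}) (x y : k) : k :=
  P.@[tnth [tuple x; y]].

Definition rectangle_values (k : fieldType) (P : {mpoly k[2]})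
    (v : 4.-tuple k) : Prop :=
  exists a b c d : k,
    v = [tuple eval2 P a c; eval2 P a d; eval2 P b c; eval2 P b d].

(* Main.v *)
Require Import Defs.
From mathcomp Require Import all_boot all_order all_algebra.
From mathcomp Require Import mpoly ring zify.
From Stdlib Require Import Classical.

Set Implicit Arguments.
Unset Strict Implicit.
Unset Printing Implicit Defensive.

Import GRing.Theory.
Local Open Scope ring_scope.

(* An algebraic relation between the four rectangle values forces their Jacobian
   determinant to vanish, and freezing two of its four variables turns this into
   a(x) d(y) P_x = b(x) c(y) P_y with nonzero univariate a, b, c, d.

   Let R be the ring of polynomials f with a d f_x = b c f_y. Since b(x) and d(y)
   are coprime, each f in R has a polynomial derivative T f along the closed form
   (b/a) dx + (d/c) dy, namely a f_x = b (T f) and c f_y = d (T f), and T f lies in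
   R again. The first equation shows that T shifts the degree in x by
   deg a - deg b - 1 on nonconstant elements, and the second that this shift is
   not positive.

   If the shift is negative, T is locally nilpotent: some h has T h = 1, so that
   R = k[h], and h splits as F(x) + G(y). If the shift is zero, T multiplies the
   leading coefficient of an f of degree n by n mu with mu = lc(a)/lc(b), so every
   f is a sum of eigenvectors with eigenvalues j mu. An eigenvector is a product
   A(x) B(y), the one with the smallest positive j divides all those with larger
   j, and by Euclidean descent all eigenvectors are scalar multiples of its powers. *)

(** Well-ordering for a predicate without a decision procedure; it will select the smallest positive
    eigenvalue index. *)
Lemma ex_least (A : nat -> Prop) :
  (exists n, A n) -> exists2 n, A n & forall m, A m -> (n <= m)%N.
Proof.
move=> [n An]; apply: NNPP => noleast.
elim/ltn_ind: n An => n IH An; apply: noleast; exists n => // m Am.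
by rewrite leqNgt; apply/negP => /IH; apply.
Qed.

(** * Degrees, roots and derivatives over a domain of characteristic zero *)

Section CharZeroDomain.

Variable R : idomainType.
Hypothesis natR : forall n, n.+1%:R != 0 :> R.

Implicit Type p : {poly R}.

Lemma natr_inj_char0 (m n : nat) : m%:R = n%:R :> R -> m = n.
Proof.
wlog lemn : m n / (m <= n)%N => [W|] eq_mn.
  by case: (leqP m n) => [|/ltnW] /W; [apply|move/(_ (esym eq_mn))].
have : (n - m)%:R = 0 :> R by rewrite natrB // eq_mn subrr.
by case E: (n - m)%N => [|d] => [|/eqP]; [lia|rewrite (negPf (natR d))].
Qed.

Lemma poly_eq0_nat p : (forall n : nat, p.[n%:R] = 0) -> p = 0.
Proof.
move=> p0; apply/eqP/negPn/negP => pn0.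
pose s := [seq n%:R : R | n <- iota 0 (size p)].
have rs : all (root p) s by apply/allP => x /mapP[n _ ->]; apply/eqP/p0.
have us : uniq s by rewrite map_inj_uniq ?iota_uniq //; exact: natr_inj_char0.
by have := max_poly_roots pn0 rs us; rewrite size_map size_iota ltnn.
Qed.

Lemma coef_deriv_last p : p^`()`_(size p).-2 = lead_coef p *+ (size p).-1.
Proof.
rewrite coef_deriv; case E: (size p) => [|[|n]] /=; rewrite ?mulr0n.
- by rewrite [p]size1_polyC ?E // coefC.
- by rewrite [p]size1_polyC ?E // coefC.
- by rewrite lead_coefE E.
Qed.

Lemma size_deriv_char0 p : size p^`() = (size p).-1.
Proof.
have [lt1|gt1] := leqP (size p) 1.
  by rewrite [p in LHS]size1_polyC // derivC size_poly0; case: (size p) lt1 => [|[]].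
have pn0 : p != 0 by rewrite -size_poly_gt0 ltnW.
apply/eqP; rewrite eqn_leq; apply/andP; split.
  by rewrite -ltnS (leq_trans (lt_size_deriv pn0)) //; lia.
rewrite -(prednK (n := (size p).-1)); last by lia.
rewrite ltnNge; apply/negP => /leq_sizeP/(_ _ (leqnn _)).
rewrite coef_deriv_last -mulr_natr => /eqP; rewrite mulf_eq0 lead_coef_eq0.
rewrite (negPf pn0) /=; case: (size p) gt1 => [|[|n]] //= _.
by rewrite (negPf (natR _)).
Qed.

Lemma lead_coef_deriv_char0 p :
  lead_coef p^`() = lead_coef p *+ (size p).-1.
Proof. by rewrite lead_coefE size_deriv_char0 coef_deriv_last. Qed.

Lemma deriv_eq0_char0 p : p^`() = 0 -> p = (p`_0)%:P.
Proof.
move=> p'0; apply: size1_polyC; have := size_deriv_char0 p.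
by rewrite p'0 size_poly0; case: (size p) => [|[]].
Qed.

End CharZeroDomain.

(** * First-order linear differential equations in one variable *)

Section Univariate.

Variable k : fieldType.
Hypothesis natk : forall n, n.+1%:R != 0 :> k.

Implicit Types p q s t : {poly k}.

(* A nonzero solution [p] of the Wronskian equation has the degree of [q]. *)
Lemma wronskian_eq0 p q : q != 0 -> p^`() * q = p * q^`() ->
  p = (p`_(size q).-1 / lead_coef q) *: q.
Proof.
move=> qn0 W; set c := _ / _.
have sizeW r : r != 0 -> r^`() * q = r * q^`() -> size r = size q.
  move=> rn0 /(congr1 lead_coef); rewrite !lead_coefM !lead_coef_deriv_char0 //.
  rewrite mulrnAl mulrnAr -[LHS]mulr_natr -[RHS]mulr_natr => /mulfI.
  rewrite mulf_neq0 ?lead_coef_eq0 // => /(_ isT)/natr_inj_char0.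
  move: rn0 qn0; rewrite -!size_poly_gt0.
  by case: (size r) (size q) => [|i] [|j] //= _ _ ->.
apply/eqP; rewrite -subr_eq0; apply/negPn/negP => rn0.
(* The difference solves the same equation, so it would have the size of [q]; but [c] was chosen to
   cancel its coefficient in that degree. *)
have /(sizeW _ rn0) sz : (p - c *: q)^`() * q = (p - c *: q) * q^`().
  by rewrite derivB derivZ !mulrBl W -!scalerAl [q^`() * q]mulrC.
have : lead_coef (p - c *: q) == 0.
  by rewrite lead_coefE sz coefB coefZ -lead_coefE /c divfK ?lead_coef_eq0 // subrr.
by rewrite lead_coef_eq0 (negPf rn0).
Qed.

(* [p ^ n] and [q ^ m] satisfy the same first-order equation, hence are
   proportional. *)
Lemma dvdp_logderiv s t (mu : k) (m n : nat) p q :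
  s != 0 -> p != 0 -> q != 0 -> (0 < n <= m)%N ->
  s * p^`() = (m%:R * mu) *: (t * p) -> s * q^`() = (n%:R * mu) *: (t * q) ->
  q %| p.
Proof.
move=> sn0 pn0 qn0 /andP[n_gt0 le_nm] Ep Eq.
have expE r (j l : nat) : (0 < l)%N -> s * r^`() = (j%:R * mu) *: (t * r) ->
    s * (r ^+ l)^`() = (l%:R * j%:R * mu) *: (t * r ^+ l).
  move=> l_gt0 Er; rewrite deriv_exp -[X in s * X]mulr_natl mulrCA [s * _]mulrA.
  rewrite Er -scalerAl -[t * r * _]mulrA -exprS prednK // [LHS]mulr_natl
    -[LHS]scaler_nat.
  by rewrite scalerA mulrA.
have Wr : (p ^+ n)^`() * q ^+ m = p ^+ n * (q ^+ m)^`().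
  apply: (mulfI sn0); rewrite mulrA (expE _ _ _ _ Ep) // mulrCA.
  rewrite (expE _ _ _ _ Eq) ?(leq_trans n_gt0) // -!scalerAr -!scalerAl mulrCA mulrA.
  by rewrite [n%:R * _]mulrC.
have qmn0 : q ^+ m != 0 by rewrite expf_neq0.
(* As [n <= m], [q ^+ n] divides [q ^+ m], which is a nonzero multiple of [p ^+ n]; divisibility of
   [n]-th powers descends to the bases. *)
rewrite -(@dvdp_pexp2r _ _ _ n) // (wronskian_eq0 qmn0 Wr).
rewrite dvdpZr ?dvdp_exp2l //; apply: contraTN (expf_neq0 n pn0) => /eqP c0.
by rewrite (wronskian_eq0 qmn0 Wr) c0 scale0r eqxx.
Qed.

End Univariate.

(** * Bivariate polynomials and their partial derivatives *)

Section Bivariate.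

Variable k : fieldType.
Hypothesis natk : forall n, n.+1%:R != 0 :> k.

(* Bivariate polynomials are elements of k[y][x]: the outer variable is x. *)
Implicit Types (f g h : {poly {poly k}}) (p q : {poly k}).

Definition deriv_y f : {poly {poly k}} := map_poly (@deriv k) f.

Local Notation "p ^X" := (map_poly polyC p) (at level 2, format "p ^X").
Local Notation kappa z := (z%:P%:P : {poly {poly k}}).

Lemma coef_deriv_y f i : (deriv_y f)`_i = (f`_i)^`().
Proof. by rewrite coef_map_id0 // deriv0. Qed.

Lemma deriv_yD f g : deriv_y (f + g) = deriv_y f + deriv_y g.
Proof. by apply/polyP => i; rewrite !(coefD, coef_deriv_y) derivD. Qed.

Lemma deriv_yM f g : deriv_y (f * g) = deriv_y f * g + f * deriv_y g.
Proof.
apply/polyP => i; rewrite coefD coef_deriv_y !coefM raddf_sum -big_split /=.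
by apply: eq_bigr => j _; rewrite derivM !coef_deriv_y.
Qed.

Lemma deriv_yC p : deriv_y p%:P = p^`()%:P.
Proof.
by apply/polyP => i; rewrite coef_deriv_y !coefC; case: eqP; rewrite ?deriv0.
Qed.

Lemma deriv_y_liftX p : deriv_y p^X = 0.
Proof. by apply/polyP => i; rewrite coef_deriv_y coef_map derivC coef0. Qed.

Lemma deriv_deriv_y f : (deriv_y f)^`() = deriv_y f^`().
Proof.
by apply/polyP => i; rewrite coef_deriv !coef_deriv_y coef_deriv derivMn.
Qed.

Lemma natr_poly_neq0 n : n.+1%:R != 0 :> {poly k}.
Proof. by rewrite -polyC_natr polyC_eq0 natk. Qed.

Lemma size_liftX p : size p^X = size p.
Proof. by rewrite size_map_inj_poly //; exact: polyC_inj. Qed.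

Lemma liftX_eq0 p : (p^X == 0) = (p == 0).
Proof. by rewrite -!size_poly_eq0 size_liftX. Qed.

Lemma lead_coef_liftX p : lead_coef p^X = (lead_coef p)%:P.
Proof. by rewrite lead_coef_map_inj //; exact: polyC_inj. Qed.

Lemma size_deriv_y f : (size (deriv_y f) <= size f)%N.
Proof. exact: size_poly. Qed.

(* [b] has a unit leading coefficient in x while [d] is a constant in x, so
   they are coprime in the strong sense that they divide each other's cofactor. *)
Lemma cofactors_split b d f g : b != 0 -> d != 0 ->
  d%:P * f = b^X * g -> exists h, f = b^X * h /\ g = d%:P * h.
Proof.
move=> bn0 dn0 E.
have ub : lead_coef b^X \is a GRing.unit.
  by rewrite lead_coef_liftX rmorph_unit // unitfE lead_coef_eq0.
have bXn0 : b^X != 0 by rewrite liftX_eq0.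
have E' : b^X * (g - d%:P * (f %/ b^X)) = d%:P * (f %% b^X).
  rewrite mulrBr -E {1}(Pdiv.IdomainUnit.divp_eq ub f); ring.
(* Sizes in x decide: a nonzero cofactor makes the left side of [E'] at least as large as [b^X],
   while the right side is a remainder modulo [b^X]. *)
have z0 : g - d%:P * (f %/ b^X) = 0.
  apply/eqP/negPn/negP => zn0; have := congr1 (fun u : {poly {poly k}} => size u) E'.
  rewrite /= size_mul // [in RHS]mul_polyC size_scale //.
  have := ltn_modp f b^X; rewrite bXn0 => lt.
  move: zn0; rewrite -size_poly_gt0 => gt0.
  move=> E2; move: lt; rewrite -E2.
  by case: (size (g - _)) gt0 => // n _; rewrite addnS /= ltnNge leq_addr.
exists (f %/ b^X); split; last by apply/eqP; rewrite -subr_eq0 z0.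
have m0 : f %% b^X = 0.
  by move/eqP: E'; rewrite z0 mulr0 eq_sym mulf_eq0 polyC_eq0 (negPf dn0) => /eqP.
by rewrite {1}(Pdiv.IdomainUnit.divp_eq ub f) m0 addr0 mulrC.
Qed.

(** * Polynomial derivatives along a closed form *)

Variables a b c d : {poly k}.
Hypotheses (an0 : a != 0) (bn0 : b != 0) (cn0 : c != 0) (dn0 : d != 0).

(* [g] is the derivative of [f] along the closed form (b/a) dx + (d/c) dy. *)
Definition along f g :=
  a^X * f^`() = b^X * g /\ c%:P * deriv_y f = d%:P * g.

(** Grouped as d (a f_x) = b (c f_y), the equation falls under [cofactors_split], and the common
    cofactor is the derivative. *)
Lemma along_ex f : a^X * d%:P * f^`() = b^X * c%:P * deriv_y f ->
  exists g, along f g.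
Proof.
move=> E; have [|h [Ex Ey]] := @cofactors_split b d (a^X * f^`())
  (c%:P * deriv_y f) bn0 dn0.
  by rewrite mulrCA mulrA E mulrA.
by exists h.
Qed.

(** Equality of mixed partials: both b c g_y and a d g_x equal a c f_xy, so [g] satisfies the
    equation required by [along_ex]. *)
Lemma along_iter f g : along f g -> exists h, along g h.
Proof.
move=> [Ex Ey]; apply: along_ex.
have /(congr1 (fun u : {poly {poly k}} => c%:P * u)) := congr1 deriv_y Ex.
have /(congr1 (fun u : {poly {poly k}} => a^X * u)) := congr1 (fun u => u^`()) Ey.
rewrite !derivM !derivC !deriv_yM !deriv_y_liftX !mul0r !add0r deriv_deriv_y.
rewrite !mulrA => <- E; rewrite [b^X * _]mulrC -E; ring.
Qed.

Lemma along0 : along 0 0.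
Proof. by split; rewrite ?deriv0 ?mulr0 // /deriv_y map_poly0 !mulr0. Qed.

Lemma alongD f1 g1 f2 g2 : along f1 g1 -> along f2 g2 ->
  along (f1 + f2) (g1 + g2).
Proof.
by move=> [x1 y1] [x2 y2]; split; rewrite ?derivD ?deriv_yD !mulrDr ?x1 ?x2 ?y1 ?y2.
Qed.

Lemma alongM f1 g1 f2 g2 : along f1 g1 -> along f2 g2 ->
  along (f1 * f2) (g1 * f2 + f1 * g2).
Proof.
move=> [x1 y1] [x2 y2]; split; rewrite ?derivM ?deriv_yM !mulrDr mulrA.
  by rewrite x1 mulrCA x2; ring.
by rewrite y1 mulrCA y2; ring.
Qed.

Lemma along_const z : along (kappa z) 0.
Proof. by split; rewrite ?derivC ?deriv_yC ?derivC !mulr0. Qed.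

Lemma alongZ z f g : along f g -> along (kappa z * f) (kappa z * g).
Proof. by move=> A; have := alongM (along_const z) A; rewrite mul0r add0r. Qed.

Lemma alongB f1 g1 f2 g2 : along f1 g1 -> along f2 g2 ->
  along (f1 - f2) (g1 - g2).
Proof.
move=> A1 A2; have := alongD A1 (alongZ (-1) A2).
by rewrite !polyCN !mulN1r.
Qed.

Lemma along_sum (I : Type) (r : seq I) (F G : I -> {poly {poly k}}) :
  (forall i, along (F i) (G i)) -> along (\sum_(i <- r) F i) (\sum_(i <- r) G i).
Proof.
by move=> A; apply: (big_ind2 along along0) => // *; apply: alongD.
Qed.

Lemma along_exp f g n : along f g ->
  along (f ^+ n.+1) (kappa n.+1%:R * (f ^+ n * g)).
Proof.
move=> A; elim: n => [|n IH]; first by rewrite !expr1 expr0 !mul1r.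
have := alongM A IH; rewrite -exprS; congr along.
by rewrite !polyC_natr [f ^+ n.+1]exprS -[n.+2]add1n natrD; ring.
Qed.

Lemma along_uniq f g1 g2 : along f g1 -> along f g2 -> g1 = g2.
Proof.
move=> [x1 _] [x2 _]; apply: (mulfI (_ : b^X != 0)); first by rewrite liftX_eq0.
by rewrite -x1.
Qed.

Lemma along_eq0 f : along f 0 -> exists z, f = kappa z.
Proof.
move=> [/eqP Ex /eqP Ey]; move: Ex Ey; rewrite !mulr0 !mulf_eq0.
rewrite liftX_eq0 polyC_eq0 (negPf an0) (negPf cn0) /= => /eqP x0 /eqP.
rewrite (deriv_eq0_char0 natr_poly_neq0 x0) deriv_yC => /eqP.
rewrite polyC_eq0 => /eqP y0; exists f`_0`_0.
by rewrite -(deriv_eq0_char0 natk y0).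
Qed.

Lemma along_const0 z g : along (kappa z) g -> g = 0.
Proof. by move/along_uniq; apply; apply: along_const. Qed.

(** Sizes measure degree in x, where c(y) and d(y) do not count. The x-equation gives the exact
    shift; the y-equation gives [g] the size of [deriv_y f]. *)
Lemma size_along f g : along f g -> (1 < size f)%N ->
  (size a + (size f).-1 = size b + size g)%N /\ (0 < size g <= size f)%N.
Proof.
move=> [Ex Ey] lt1.
have f'n0 : f^`() != 0.
  by rewrite -size_poly_gt0 (size_deriv_char0 natr_poly_neq0) -subn1 subn_gt0.
have gn0 : g != 0.
  apply/eqP => g0; move/eqP: Ex; rewrite g0 mulr0 mulf_eq0 liftX_eq0.
  by rewrite (negPf an0) (negPf f'n0).
split.
  have := congr1 (fun u : {poly {poly k}} => size u) Ex.
  rewrite /= !size_mul ?liftX_eq0 // !size_liftX (size_deriv_char0 natr_poly_neq0).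
  move: an0 bn0; rewrite -!size_poly_gt0.
  by case: (size a) (size b) => [|i] [|j] // _ _; rewrite !addSn /= => ->.
rewrite size_poly_gt0 gn0 /=; apply: leq_trans (size_deriv_y f).
have := congr1 (fun u : {poly {poly k}} => size u) Ey.
by rewrite /= !mul_polyC !size_scale // => ->.
Qed.

(** If x does not occur then f_x = 0, so the x-equation forces [g = 0], and the y-equation then
    removes y as well. *)
Lemma along_small f g : along f g -> (size f <= 1)%N -> exists z, f = kappa z.
Proof.
move=> A le1; apply: along_eq0; suff <- : g = 0 by [].
case: A => Ex _; move/eqP: Ex; rewrite [f]size1_polyC // derivC mulr0 eq_sym.
by rewrite mulf_eq0 liftX_eq0 (negPf bn0) => /eqP.
Qed.

Lemma along_neq0_size f g : along f g -> g != 0 -> (1 < size f)%N.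
Proof.
move=> A; apply: contraR; rewrite -leqNgt => le1.
by have [z fz] := along_small A le1; move: A; rewrite fz => /along_const0/eqP.
Qed.

Lemma horner2_liftX p x y : p^X.[x%:P].[y] = p.[x].
Proof. by rewrite horner_map hornerC. Qed.

(** * Negative degree shift: a locally nilpotent derivation *)

Section Additive.

Hypothesis le_ab : (size a <= size b)%N.

Lemma size_along_lt f g : along f g -> (1 < size f)%N -> (size g < size f)%N.
Proof. by move=> A lt1; have [E _] := size_along A lt1; lia. Qed.

(** Differentiation strictly lowers the degree in x, so iterating it reaches a nonzero constant;
    rescaling the polynomial just before gives [h], a slice of the derivation. *)
Lemma along_slice f g : along f g -> g != 0 -> exists h, along h 1.
Proof.
have [n] := ubnP (size f); elim: n => // n IH in f g *; rewrite ltnS => le_fn A gn0.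
have lt1 := along_neq0_size A gn0.
have lt_gf := size_along_lt A lt1; have [g' A'] := along_iter A.
have [le1|gt1] := leqP (size g) 1; last first.
  apply: (IH g g') => //; first exact: leq_trans le_fn.
  by have [_ /andP[]] := size_along A' gt1; rewrite size_poly_gt0.
have [z gz] := along_small A' le1.
have zn0 : z != 0 by apply: contraNneq gn0; rewrite gz => ->; rewrite polyC0.
by exists (kappa z^-1 * f); have := alongZ z^-1 A; rewrite gz -!polyCM mulVf.
Qed.

(** By induction the derivative of [f] is a polynomial in [h]. Integrating it term by term in [h]
    gives [F], and [f - F] has derivative zero, hence is constant. *)
Lemma along_slice_span h f g : along h 1 -> along f g ->
  exists n (z : nat -> k), f = \sum_(i < n) kappa (z i) * h ^+ i.
Proof.
move=> Ah; have [m] := ubnP (size f).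
elim: m => // m IH in f g *; rewrite ltnS => le_fm A.
have [le1|gt1] := leqP (size f) 1.
  have [z ->] := along_small A le1.
  by exists 1%N, (fun=> z); rewrite big_ord1 expr0 mulr1.
have [g' A'] := along_iter A.
have [n [z gz]] := IH g g' (leq_trans (size_along_lt A gt1) le_fm) A'.
pose w i := z i / i.+1%:R; pose F := \sum_(i < n) kappa (w i) * h ^+ i.+1.
have AF : along F g.
  rewrite gz; apply: along_sum => i.
  have := alongZ (w i) (along_exp i Ah).
  by rewrite mulr1 mulrA -!polyCM divfK ?natk.
have := alongB A AF; rewrite subrr => /along_eq0[v Ev].
exists n.+1, (fun i => if i is j.+1 then w j else v).
by rewrite big_ord_recl expr0 mulr1 -Ev subrK.
Qed.

(** Differentiating a(x) h_x = b(x) in y gives h_xy = 0, so only the coefficient of x^0 can involve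
    y. *)
Lemma slice_additive h : along h 1 -> exists F G : {poly k}, h = F^X + G%:P.
Proof.
move=> [Ex _].
have hxy i : (h`_i.+1)^`() = 0.
  have /eqP := congr1 deriv_y Ex.
  rewrite mulr1 deriv_yM !deriv_y_liftX mul0r add0r mulf_eq0 liftX_eq0 (negPf an0).
  move=> /eqP/(congr1 (fun u : {poly {poly k}} => u`_i)) /=.
  rewrite coef_deriv_y coef_deriv derivMn coef0 -mulr_natr => /eqP.
  by rewrite mulf_eq0 (negPf (natr_poly_neq0 i)) orbF => /eqP.
(* The constant term of [h] is already counted in the first witness, so it is subtracted from the
   second. *)
exists (map_poly (coefp 0) h), (h`_0 - (h`_0`_0)%:P).
apply/polyP => -[|i]; rewrite coefD coefC !coef_map /=.
  by rewrite addrC subrK.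
by rewrite addr0 (deriv_eq0_char0 natk (hxy i)) coefC.
Qed.

Lemma along_additive f g : along f g -> g != 0 ->
  exists Q F G : {poly k},
    forall x y, f.[x%:P].[y] = Q.[F.[x] + G.[y]].
Proof.
move=> A gn0; have [h Ah] := along_slice A gn0.
have [n [z ->]] := along_slice_span Ah A; have [F [G ->]] := slice_additive Ah.
exists (\sum_(i < n) z i *: 'X^i), F, G => x y.
rewrite !horner_sum; apply: eq_bigr => i _.
by rewrite !hornerE /= horner2_liftX.
Qed.

End Additive.

(** * Zero degree shift: a diagonalizable derivation *)

Section Multiplicative.

Hypothesis size_ab : size a = (size b).+1.

Let mu := lead_coef a / lead_coef b.

Let mu_neq0 : mu != 0.
Proof. by rewrite mulf_neq0 ?invr_eq0 ?lead_coef_eq0. Qed.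

(** Comparing leading coefficients in a f_x = b g, the coefficient of x^N in [g] is N mu times that
    in [f], so subtracting this multiple of [f] cancels it. *)
Lemma size_along_sub f g N : along f g -> (size f <= N.+1)%N ->
  (size (g - kappa (N%:R * mu) * f)%R <= N)%N.
Proof.
move=> A le_fN; have [le1|gt1] := leqP (size f) 1.
  have [z fz] := along_small A le1; move: A; rewrite fz => /along_const0 ->.
  rewrite sub0r size_polyN; case: N le_fN => [|N] _.
    by rewrite !mul0r size_poly0.
  by rewrite -polyCM (leq_trans (size_polyC_leq1 _)).
have [E _] := size_along A gt1.
have sz_g : size g = size f.
  by move: E; rewrite size_ab addSnnS prednK ?(ltnW gt1) // => /addnI.
have [Ex _] := A; move/(congr1 lead_coef): Ex.
rewrite !lead_coefM !lead_coef_liftX (lead_coef_deriv_char0 natr_poly_neq0) => El.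
apply/leq_sizeP => j; rewrite leq_eqVlt => /predU1P[<-|lt_Nj]; last first.
  rewrite coefB mul_polyC coefZ !nth_default ?mulr0 ?subrr ?sz_g //.
    exact: leq_trans lt_Nj.
  exact: leq_trans lt_Nj.
rewrite coefB mul_polyC coefZ; move: le_fN.
rewrite leq_eqVlt => /predU1P[sz_f|lt_fN].
  have -> : f`_N = lead_coef f by rewrite lead_coefE sz_f.
  have -> : g`_N = lead_coef g by rewrite lead_coefE sz_g sz_f.
  have lbn0 : (lead_coef b)%:P != 0 :> {poly k} by rewrite polyC_eq0 lead_coef_eq0.
  apply: (mulfI lbn0); rewrite mulrBr mulr0 -El sz_f /= mulrA -polyCM.
  have -> : lead_coef b * (N%:R * mu) = lead_coef a * N%:R.
    by rewrite /mu; field; rewrite lead_coef_eq0.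
  by rewrite -[lead_coef f *+ N]mulr_natr polyCM polyC_natr; ring.
by rewrite !nth_default ?mulr0 ?subrr ?sz_g // -ltnS.
Qed.

(** Write T for the derivation and nu for the top eigenvalue. By induction T f - nu f is a sum of
    eigenvectors with smaller indices. On these T - nu is invertible, which gives [F] with T F - nu
    F = T f - nu f, so that [f - F] is an eigenvector for nu. *)
Lemma along_eigen_sum N f g : along f g -> (size f <= N.+1)%N ->
  exists2 e : nat -> {poly {poly k}}, f = \sum_(j < N.+1) e j
    & forall j, along (e j) (kappa (j%:R * mu) * e j).
Proof.
elim: N f g => [|N IH] f g A le_fN.
  have [z fz] := along_small A le_fN.
  exists (fun j => if j is 0 then f else 0); first by rewrite big_ord1.
  case=> [|j]; rewrite ?mulr0; last exact: along0.
  by rewrite fz !mul0r; exact: along_const.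
have [g' A'] := along_iter A; set nu := N.+1%:R * mu.
have [e1 Eg Ae1] := IH _ _ (alongB A' (alongZ nu A)) (size_along_sub A le_fN).
(* The inverse of j mu - nu, the scalar by which T - nu acts on [e1 j]. *)
pose w j := ((j%:R - N.+1%:R) * mu)^-1.
pose F := \sum_(j < N.+1) kappa (w j) * e1 j.
have AF : along F (\sum_(j < N.+1) kappa (w j) * (kappa (j%:R * mu) * e1 j)).
  by apply: along_sum => j; apply: alongZ.
(* Beyond [N.+1] the family is zero, since the eigenvector equation is asked of every [j]. *)
exists (fun j => if (j < N.+1)%N then kappa (w j) * e1 j
                 else if j == N.+1 then f - F else 0).
  rewrite big_ord_recr /= ltnn eqxx (eq_bigr (fun j : 'I__ => kappa (w j) * e1 j)).
    by rewrite -/F addrC subrK.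
  by move=> j _; rewrite ltn_ord.
move=> j; case: ltnP => lt_jN.
  by rewrite mulrCA; apply: alongZ.
case: eqP => [->|_]; last by rewrite mulr0; apply: along0.
suff -> : kappa nu * (f - F)
    = g - \sum_(j < N.+1) kappa (w j) * (kappa (j%:R * mu) * e1 j).
  exact: alongB.
rewrite -[g](subrK (kappa nu * f)) Eg mulrBr addrAC -sumrB.
rewrite addrC; congr (_ + _); rewrite /F mulr_sumr -sumrN.
apply: eq_bigr => i _.
have wE : w i * (i%:R * mu - nu) = 1.
  rewrite /w -mulrBl mulVf // mulf_neq0 // subr_eq0; apply/eqP => /natr_inj_char0.
  by move=> /(_ natk) E; have := ltn_ord i; rewrite E ltnn.
have wE2 : kappa (w i) * (kappa (i%:R * mu) - kappa nu) = 1.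
  by rewrite -!polyCB -!polyCM wE.
by rewrite -[X in _ = X - _]mul1r -wE2; ring.
Qed.

(** The eigenvector equation for A(x) B(y) split by variable: A'/A = n mu b/a and B'/B = n mu
    d/c. *)
Definition eigenpair (n : nat) (A B : {poly k}) :=
  [/\ A != 0, B != 0, a * A^`() = (n%:R * mu) *: (b * A)
    & c * B^`() = (n%:R * mu) *: (d * B)].

(** Since c and d are free of x, the y-equation holds for each coefficient of [e] in x. All of them
    solve one first-order equation in y, hence are multiples of the leading coefficient [B]; the
    multipliers form [A]. *)
Lemma along_eigenpair n e : e != 0 -> along e (kappa (n%:R * mu) * e) ->
  exists A B, eigenpair n A B /\ e = A^X * B%:P.
Proof.
set lam := _ * mu => en0 [Ex Ey]; pose B := lead_coef e.
have Bn0 : B != 0 by rewrite lead_coef_eq0.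
have Eyi i : c * (e`_i)^`() = lam *: (d * e`_i).
  have := congr1 (fun u : {poly {poly k}} => u`_i) Ey.
  by rewrite /= !coefCM coef_deriv_y => ->; rewrite mulrCA mul_polyC.
have W i : e`_i = ((e`_i)`_(size B).-1 / lead_coef B) *: B.
  apply: wronskian_eq0 => //; apply: (mulfI cn0).
  rewrite mulrA Eyi mulrCA (Eyi (size e).-1) -lead_coefE -/B.
  by rewrite -scalerAl -scalerAr; congr (_ *: _); ring.
pose A := \poly_(i < size e) ((e`_i)`_(size B).-1 / lead_coef B).
have eAB : e = A^X * B%:P.
  apply/polyP => i; rewrite coefMC coef_map coef_poly /= mul_polyC.
  case: ltnP => [_|le_ei]; first exact: W.
  by rewrite nth_default // scale0r.
have An0 : A != 0.
  by apply: contraNneq en0; rewrite eAB => ->; rewrite map_poly0 mul0r.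
exists A, B; split=> //; split=> //; last exact: Eyi.
have BPn0 : B%:P != 0 :> {poly {poly k}} by rewrite polyC_eq0.
apply: (@map_inj_poly _ _ (@polyC k)) => //; first exact: polyC_inj.
apply: (mulIf BPn0); move: Ex; rewrite eAB derivM derivC mulr0 addr0 deriv_map.
rewrite mulrA -rmorphM => ->; rewrite -mul_polyC.
have -> : (lam%:P * (b * A))^X = kappa lam * (b^X * A^X).
  by rewrite rmorphM /= map_polyC /= [(b * A)^X]rmorphM.
ring.
Qed.

Lemma eigenpair0 A B : eigenpair 0 A B -> exists z, forall x y, A.[x] * B.[y] = z.
Proof.
case=> _ _; rewrite mul0r !scale0r => /eqP.
rewrite mulf_eq0 (negPf an0) /= => /eqP A'0.
move=> /eqP; rewrite mulf_eq0 (negPf cn0) /= => /eqP B'0.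
rewrite (deriv_eq0_char0 natk A'0) (deriv_eq0_char0 natk B'0).
by exists (A`_0 * B`_0) => x y; rewrite !hornerC.
Qed.

(** Divisibility comes from [dvdp_logderiv] in each variable; logarithmic derivatives of quotients
    subtract, so the index of the quotient is [m - n]. *)
Lemma eigenpair_div m n A B A0 B0 : (0 < n <= m)%N ->
  eigenpair m A B -> eigenpair n A0 B0 ->
  exists A1 B1, [/\ A = A1 * A0, B = B1 * B0 & eigenpair (m - n) A1 B1].
Proof.
move=> nm [An0 Bn0 EA EB] [A0n0 B0n0 EA0 EB0].
have le_nm : (n <= m)%N by case/andP: nm.
have divE (s t p q r : {poly k}) : q != 0 -> p = r * q ->
    s * p^`() = (m%:R * mu) *: (t * p) -> s * q^`() = (n%:R * mu) *: (t * q) ->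
    s * r^`() = ((m - n)%:R * mu) *: (t * r).
  move=> qn0 -> Ep Eq; apply: (mulIf qn0).
  have -> : s * r^`() * q = s * (r * q)^`() - r * (s * q^`()).
    by rewrite derivM; ring.
  by rewrite Ep Eq natrB // mulrBl -!mul_polyC polyCB; ring.
have /dvdpP[A1 A1E] := dvdp_logderiv natk an0 An0 A0n0 nm EA EA0.
have /dvdpP[B1 B1E] := dvdp_logderiv natk cn0 Bn0 B0n0 nm EB EB0.
exists A1, B1; split=> //; split.
- by apply: contraNneq An0; rewrite A1E => ->; rewrite mul0r.
- by apply: contraNneq Bn0; rewrite B1E => ->; rewrite mul0r.
- exact: divE A1E EA EA0.
- exact: divE B1E EB EB0.
Qed.

(** Euclidean descent: dividing by a pair of least positive index lowers the index until it reaches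
    0, where the product is constant. The index never gets stuck strictly between, by minimality. *)
Lemma eigenpair_generator : exists A0 B0 : {poly k}, forall n A B,
  eigenpair n A B ->
  exists (z : k) (n : nat), forall x y, A.[x] * B.[y] = z * (A0.[x] * B0.[y]) ^+ n.
Proof.
pose posE n := (0 < n)%N /\ exists A B, eigenpair n A B.
case: (classic (exists n, posE n)) => [/ex_least|noE]; last first.
  (* Without a positive index every eigenpair has a constant product, so any generator will do. *)
  exists 1, 1 => -[|n] A B E; last first.
    by case: noE; exists n.+1; split=> //; exists A, B.
  by have [z zE] := eigenpair0 E; exists z, 0%N => x y; rewrite zE expr0 mulr1.
move=> [n [n_gt0 [A0 [B0 E0]]] minn]; exists A0, B0.
elim/ltn_ind => -[|m] IH A B E.
  by have [z zE] := eigenpair0 E; exists z, 0%N => x y; rewrite zE expr0 mulr1.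
have le_nm : (n <= m.+1)%N by apply: minn; split=> //; exists A, B.
have [|A1 [B1 [-> -> E1]]] := eigenpair_div _ E E0; first by rewrite n_gt0.
have [|z [q zE]] := IH _ _ _ _ E1; first by rewrite ltn_subrL n_gt0.
by exists z, q.+1 => x y; rewrite !hornerM mulrACA zE exprSr -[LHS]mulrA.
Qed.

Lemma along_multiplicative f g : along f g ->
  exists Q F G : {poly k},
    forall x y, f.[x%:P].[y] = Q.[F.[x] * G.[y]].
Proof.
move=> A; have [e -> Ae] := along_eigen_sum A (leqnSn _).
have [F [G gen]] := eigenpair_generator.
suff [Q QE] : exists Q : {poly k}, forall x y,
    (\sum_(j < (size f).+1) e j).[x%:P].[y] = Q.[F.[x] * G.[y]] by exists Q, F, G.
apply: (big_ind (fun u => exists Q : {poly k}, forall x y,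
    u.[x%:P].[y] = Q.[F.[x] * G.[y]])) => [|u v [Q1 E1] [Q2 E2]|j _].
- by exists 0 => x y; rewrite !horner0.
- by exists (Q1 + Q2) => x y; rewrite !hornerD E1 E2.
(* A component may vanish, and then it does not factor into an eigenpair. *)
have [->|en0] := eqVneq (e j) 0; first by exists 0 => x y; rewrite !horner0.
have [B [D [/gen[z [q E]] ->]]] := along_eigenpair en0 (Ae j).
exists (z *: 'X^q) => x y; rewrite hornerM hornerC hornerM horner2_liftX E.
by rewrite hornerZ hornerXn.
Qed.

End Multiplicative.

(** The degree identity of [size_along] with [size g <= size f] bounds [size a] by [(size b).+1], so
    the two cases of the degree shift are exhaustive. *)
Lemma first_integral_structure f :
  f^`() != 0 -> a^X * d%:P * f^`() = b^X * c%:P * deriv_y f ->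
  (exists Q F G : {poly k},
     forall x y, f.[x%:P].[y] = Q.[F.[x] + G.[y]]) \/
  (exists Q F G : {poly k},
     forall x y, f.[x%:P].[y] = Q.[F.[x] * G.[y]]).
Proof.
move=> f'n0 /along_ex[g A].
have gt1 : (1 < size f)%N.
  by rewrite -subn_gt0 subn1 -(size_deriv_char0 natr_poly_neq0) size_poly_gt0.
have [E /andP[g_gt0 le_gf]] := size_along A gt1.
have [le_ab|lt_ab] := leqP (size a) (size b).
  by left; apply: (along_additive le_ab A); rewrite -size_poly_gt0.
right; apply: (along_multiplicative _ A); apply/eqP; rewrite eqn_leq lt_ab andbT.
rewrite -(leq_add2r (size f).-1) E addSnnS prednK ?leq_add2l //.
exact: ltnW.
Qed.

End Bivariate.

(** * Chain rule along polynomial curves, and vanishing of partial derivatives *)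

Section MultivariateChainRule.

Variables (k : fieldType) (n : nat).
Implicit Types (Phi : {mpoly k[n]}) (p : 'I_n -> {poly k}).

Lemma horner_mmap Phi p x :
  (mmap polyC p Phi).[x] = Phi.@[fun i => (p i).[x]].
Proof.
rewrite mevalE /mmap horner_sum; apply: eq_bigr => m _.
rewrite hornerM hornerC /mmap1 horner_prod; congr (_ * _).
by apply: eq_bigr => i _; rewrite horner_exp.
Qed.

(** [mmap polyC p Phi] is [Phi] restricted to the curve [p]. The chain rule holds for the variables
    and passes to products, scalar multiples and sums. *)
Lemma deriv_mmap Phi p :
  (mmap polyC p Phi)^`() = \sum_i mmap polyC p (Phi^`M(i)) * (p i)^`().
Proof.
pose chain (F : {mpoly k[n]}) := (mmap polyC p F)^`() =
  \sum_i mmap polyC p (F^`M(i)) * (p i)^`().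
have chain1 : chain 1.
  rewrite /chain rmorph1 -polyC1 derivC big1 // => i _.
  by rewrite -mpolyC1 mderivC rmorph0 mul0r.
have chainM F G : chain F -> chain G -> chain (F * G).
  rewrite /chain rmorphM derivM /= => -> ->.
  rewrite mulr_suml mulr_sumr -big_split; apply: eq_bigr => i _ /=.
  by rewrite mderivM rmorphD !rmorphM /=; ring.
have chainX i : chain 'X_i.
  have subUU : (U_(i) - U_(i) = 0 :> 'X_{1..n})%MM.
    by apply/mnmP => j; rewrite mnmBE subnn mnm0E.
  rewrite /chain mmapX mmap1U (bigD1 i) //= big1 ?addr0 => [|j neq_ji].
    by rewrite mderivX mnm1E eqxx scale1r subUU mmapX mmap11 mul1r.
  by rewrite mderivX mnm1E eq_sym (negPf neq_ji) scale0r rmorph0 mul0r.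
rewrite -/(chain Phi); elim/mpolyind: Phi => [|c m F _ _ IH].
  by rewrite /chain rmorph0 deriv0 big1 // => i _; rewrite linear0 rmorph0 mul0r.
have chainXm : chain 'X_[m].
  rewrite mpolyXE_id; apply: (big_ind chain) => // i _.
  by elim: (m i) => [|j IHj]; rewrite ?expr0 // exprS; apply: chainM.
rewrite /chain rmorphD derivD IH /= mmapZ derivM derivC mul0r add0r chainXm.
rewrite mulr_sumr -big_split; apply: eq_bigr => i _ /=.
by rewrite mderivD mderivZ rmorphD /= mmapZ mulrDl mulrA.
Qed.

Lemma mderiv_sum_eq0 (char0 : forall n, n.+1%:R != 0 :> k) Phi p :
  (forall t, Phi.@[fun i => (p i).[t]] = 0) ->
  forall t, \sum_i Phi^`M(i).@[fun i => (p i).[t]] * (p i)^`().[t] = 0.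
Proof.
move=> Phi0 t.
have E0 : mmap polyC p Phi = 0.
  by apply: poly_eq0_nat => // m; rewrite horner_mmap Phi0.
have := congr1 (fun q => q^`().[t]) E0.
rewrite /= deriv_mmap horner_sum deriv0 horner0 => E; rewrite -[RHS]E.
by apply: eq_bigr => i _; rewrite hornerM horner_mmap.
Qed.

(** Raising the leading monomial of the derivative by the i-th variable gives a monomial of
    [Phi]. *)
Lemma msize_mderiv_lt Phi i : Phi^`M(i) != 0 -> (msize Phi^`M(i) < msize Phi)%N.
Proof.
move=> Dn0; rewrite -(mlead_deg Dn0); have := mlead_supp Dn0.
set m := mlead _; rewrite mcoeff_msupp mcoeff_mderiv => mn0.
have : (m + U_(i))%MM \in msupp Phi.
  by rewrite mcoeff_msupp; apply: contraNneq mn0 => ->; rewrite mul0rn.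
by move/msize_mdeg_lt; rewrite mdegD mdeg1 addn1.
Qed.

Lemma mderiv_eq0_const (char0 : forall n, n.+1%:R != 0 :> k) Phi :
  (forall i, Phi^`M(i) = 0) -> exists z, Phi = z%:MP.
Proof.
move=> D0; exists Phi@_0; apply/mpolyP => m; rewrite mcoeffC.
have [->|mn0] := eqVneq m 0%MM; first by rewrite mulr1.
have [i mi] : exists i, m i != 0%N.
  apply/existsP; apply: contraNT mn0; rewrite negb_exists => /forallP m0.
  by apply/eqP/mnmP => i; rewrite mnm0E; apply/eqP; rewrite -[_ == _]negbK m0.
(* A monomial containing the i-th variable survives in the i-th derivative with a positive integer
   factor, so its coefficient must be zero. *)
have := mcoeff_mderiv i Phi (m - U_(i)); rewrite D0 mcoeff0 submK; last first.
  by rewrite lep1mP.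
move/esym/eqP; rewrite -[X in X == _]mulr_natr mulf_eq0 (negPf (char0 _)).
rewrite orbF => /eqP->.
by rewrite mulr0.
Qed.

End MultivariateChainRule.

(** * Functions that are polynomial in each variable separately *)

Section PolynomialFunctions.

Variable k : fieldType.
Hypothesis natk : forall n, n.+1%:R != 0 :> k.

Definition polyfun (u : k -> k) := exists p : {poly k}, forall x, u x = p.[x].

Lemma polyfun_const z : polyfun (fun=> z).
Proof. by exists z%:P => x; rewrite hornerC. Qed.

Lemma polyfunM u v : polyfun u -> polyfun v -> polyfun (fun x => u x * v x).
Proof. by move=> [p up] [q vq]; exists (p * q) => x; rewrite hornerM up vq. Qed.

Lemma polyfunB u v : polyfun u -> polyfun v -> polyfun (fun x => u x - v x).
Proof.
by move=> [p up] [q vq]; exists (p - q) => x; rewrite hornerD hornerN up vq.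
Qed.

Lemma polyfun_common_neq0 u v x1 x2 : polyfun u -> polyfun v ->
  u x1 != 0 -> v x2 != 0 -> exists x, u x != 0 /\ v x != 0.
Proof.
move=> [p up] [q vq]; rewrite up vq => p1 q2; apply: NNPP => nox.
have /eqP : p * q = 0.
  apply: poly_eq0_nat => // n; rewrite hornerM; apply/eqP/negPn/negP.
  by rewrite mulf_eq0 negb_or -up -vq => /andP[u0 v0]; apply: nox; exists n%:R.
by rewrite mulf_eq0 => /orP[]/eqP E; [move: p1|move: q2]; rewrite E horner0 eqxx.
Qed.

Definition polyfun4 (u : k -> k -> k -> k -> k) :=
  [/\ forall b c d, polyfun (fun a => u a b c d),
      forall a c d, polyfun (fun b => u a b c d),
      forall a b d, polyfun (fun c => u a b c d)
    & forall a b c, polyfun (fun d => u a b c d)].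

(** Nonvanishing points of [u] and [v] are merged one coordinate at a time: in each variable two
    nonzero polynomials have a common point of nonvanishing. *)
Lemma polyfun4_mul_eq0 u v : polyfun4 u -> polyfun4 v ->
  (forall a b c d, u a b c d * v a b c d = 0) ->
  (exists a b c d, u a b c d != 0) -> forall a b c d, v a b c d = 0.
Proof.
move=> [u1 u2 u3 u4] [v1 v2 v3 v4] uv0 [a1 [b1 [c1 [d1 un0]]]] a2 b2 c2 d2.
apply/eqP/negPn/negP => vn0.
have [a [ua va]] := polyfun_common_neq0 (u1 b1 c1 d1) (v1 b2 c2 d2) un0 vn0.
have [b [ub vb]] := polyfun_common_neq0 (u2 a c1 d1) (v2 a c2 d2) ua va.
have [c [uc vc]] := polyfun_common_neq0 (u3 a b d1) (v3 a b d2) ub vb.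
have [d [ud vd]] := polyfun_common_neq0 (u4 a b c) (v4 a b c) uc vc.
by move/eqP: (uv0 a b c d); rewrite mulf_eq0 (negPf ud) (negPf vd).
Qed.

End PolynomialFunctions.

(** * The Jacobian of the rectangle map *)

Section Rectangles.

Variable k : fieldType.
Hypothesis natk : forall n, n.+1%:R != 0 :> k.
Implicit Types (f g : {poly {poly k}}) (a b c d x y : k).

Local Notation ev f x y := (f.[x%:P].[y]).

(** Only this section needs a definition: for fixed x, the section in y is [f.[x%:P]]. *)
Definition section_x f y : {poly k} := map_poly (horner_eval y) f.

Lemma horner_section_x f x y : (section_x f y).[x] = ev f x y.
Proof.
by rewrite -{1}[x](hornerC x y) -/(horner_eval y x%:P) horner_map.
Qed.

Lemma deriv_section_x f y : (section_x f y)^`() = section_x f^`() y.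
Proof. exact: deriv_map. Qed.

Lemma deriv_section_y f x : (f.[x%:P])^`() = (deriv_y f).[x%:P].
Proof.
rewrite horner_coef (horner_coef_wide _ (size_deriv_y f)) raddf_sum.
apply: eq_bigr => i _; rewrite /= derivM -polyC_exp derivC mulr0 addr0.
by rewrite coef_deriv_y.
Qed.

Lemma horner2_eq0 f : (forall x y, ev f x y = 0) -> f = 0.
Proof.
move=> f0; apply: (poly_eq0_nat (natr_poly_neq0 natk)) => m.
by apply: (poly_eq0_nat natk) => n; rewrite -polyC_natr f0.
Qed.

Lemma horner_mmap4 (Phi : {mpoly k[4]}) (p0 p1 p2 p3 : {poly k}) x :
  (mmap polyC (tnth [tuple p0; p1; p2; p3]) Phi).[x] =
  Phi.@[tnth [tuple p0.[x]; p1.[x]; p2.[x]; p3.[x]]].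
Proof.
rewrite horner_mmap; apply: meval_eq => -[[|[|[|[|i]]]] Hi] //;
  by rewrite !(tnth_nth 0).
Qed.

Local Notation o0 := (ord0 : 'I_4).
Local Notation o1 := (lift ord0 (ord0 : 'I_3)).
Local Notation o2 := (lift ord0 (lift ord0 (ord0 : 'I_2))).
Local Notation o3 := (lift ord0 (lift ord0 (lift ord0 (ord0 : 'I_1)))).

Lemma ord4_ind (A : 'I_4 -> Prop) : A o0 -> A o1 -> A o2 -> A o3 -> forall i, A i.
Proof.
move=> A0 A1 A2 A3 i.
have : [|| i == o0, i == o1, i == o2 | i == o3] by case: i => -[|[|[|[|]]]].
by case/or4P => /eqP->.
Qed.

Lemma mderiv_sum4_eq0 (Phi : {mpoly k[4]}) (p0 p1 p2 p3 : {poly k}) x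
    (D := fun i => Phi^`M(i).@[tnth [tuple p0.[x]; p1.[x]; p2.[x]; p3.[x]]]) :
  (forall t, Phi.@[tnth [tuple p0.[t]; p1.[t]; p2.[t]; p3.[t]]] = 0) ->
  D o0 * p0^`().[x] + D o1 * p1^`().[x] + D o2 * p2^`().[x] + D o3 * p3^`().[x] = 0.
Proof.
move=> Phi0; pose p := tnth [tuple p0; p1; p2; p3].
have Phi0' t : Phi.@[fun i => (p i).[t]] = 0.
  by rewrite -horner_mmap horner_mmap4 Phi0.
have := mderiv_sum_eq0 natk Phi0' x; rewrite !big_ord_recl big_ord0 addr0 !addrA.
by rewrite -!horner_mmap !horner_mmap4 /p !(tnth_nth 0).
Qed.

Definition rect f a b c d : 'I_4 -> k :=
  tnth [tuple ev f a c; ev f a d; ev f b c; ev f b d].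

Lemma polyfun4_rect (Phi : {mpoly k[4]}) f :
  polyfun4 (fun a b c d => Phi.@[rect f a b c d]).
Proof.
split=> s t u.
- exists (mmap polyC (tnth [tuple section_x f t; section_x f u;
     (ev f s t)%:P; (ev f s u)%:P]) Phi) => x.
  by rewrite horner_mmap4 !horner_section_x !hornerC.
- exists (mmap polyC (tnth [tuple (ev f s t)%:P; (ev f s u)%:P;
     section_x f t; section_x f u]) Phi) => x.
  by rewrite horner_mmap4 !horner_section_x !hornerC.
- exists (mmap polyC (tnth [tuple f.[s%:P]; (ev f s u)%:P;
     f.[t%:P]; (ev f t u)%:P]) Phi) => x.
  by rewrite horner_mmap4 !hornerC.
- exists (mmap polyC (tnth [tuple (ev f s u)%:P; f.[s%:P];
     (ev f t u)%:P; f.[t%:P]]) Phi) => x.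
  by rewrite horner_mmap4 !hornerC.
Qed.

(* Each multiple is the explicit combination of the hypotheses obtained by
   going once around the 4-cycle of the linear system. *)
Lemma kernel_mul_det (D0 D1 D2 D3 u0 u1 u2 u3 v0 v1 v2 v3 : k)
    (J := u0 * v1 * v2 * u3 - v0 * u1 * u2 * v3) :
  D0 * u0 + D1 * u1 = 0 -> D2 * u2 + D3 * u3 = 0 ->
  D0 * v0 + D2 * v2 = 0 -> D1 * v1 + D3 * v3 = 0 ->
  [/\ D0 * J = 0, D1 * J = 0, D2 * J = 0 & D3 * J = 0].
Proof.
set A := D0 * u0 + _; set B := D2 * u2 + _.
set C := D0 * v0 + _; set E := D1 * v1 + _.
move=> A0 B0 C0 E0; split.
- transitivity (v1 * v2 * u3 * A - u1 * v2 * u3 * E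
    + u1 * v2 * v3 * B - u1 * u2 * v3 * C);
    last by rewrite A0 B0 C0 E0; ring.
  by rewrite /J /A /B /C /E; ring.
- transitivity (u0 * v2 * u3 * E - u0 * v2 * v3 * B
    + u0 * u2 * v3 * C - v0 * u2 * v3 * A);
    last by rewrite A0 B0 C0 E0; ring.
  by rewrite /J /A /B /C /E; ring.
- transitivity (u0 * v1 * u3 * C - v0 * v1 * u3 * A
    + u1 * v0 * u3 * E - v3 * u1 * v0 * B);
    last by rewrite A0 B0 C0 E0; ring.
  by rewrite /J /A /B /C /E; ring.
- transitivity (u0 * v1 * v2 * B - u2 * u0 * v1 * C
    + v0 * u2 * v1 * A - u1 * v0 * u2 * E);
    last by rewrite A0 B0 C0 E0; ring.
  by rewrite /J /A /B /C /E; ring.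
Qed.

(** Up to sign, the Jacobian determinant of the map from (a, b, c, d) to the four rectangle values;
    its sparse matrix leaves only two terms. *)
Definition jacobian f a b c d :=
  ev f^`() a c * ev (deriv_y f) a d * ev (deriv_y f) b c * ev f^`() b d -
  ev (deriv_y f) a c * ev f^`() a d * ev f^`() b c * ev (deriv_y f) b d.

Lemma polyfun4_jacobian f : polyfun4 (jacobian f).
Proof.
have Px g y : polyfun (fun x => ev g x y).
  by exists (section_x g y) => x; rewrite horner_section_x.
have Py g x : polyfun (fun y => ev g x y) by exists g.[x%:P].
by split=> s t u; apply: polyfunB; do 3?[apply: polyfunM];
  first [exact: Px | exact: Py | exact: polyfun_const].
Qed.

(** Differentiating the relation in a, b, c and d in turn gives four linear equations for the
    gradient of [Phi], with [jacobian] as determinant up to sign. *)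
Lemma mderiv_rect_jacobian (Phi : {mpoly k[4]}) f i :
  (forall a b c d, Phi.@[rect f a b c d] = 0) ->
  forall a b c d, Phi^`M(i).@[rect f a b c d] * jacobian f a b c d = 0.
Proof.
move=> Phi0 a b c d; pose D j := Phi^`M(j).@[rect f a b c d]; rewrite -/(D i).
have Ea : D o0 * ev f^`() a c + D o1 * ev f^`() a d = 0.
  have := @mderiv_sum4_eq0 Phi (section_x f c) (section_x f d)
    (ev f b c)%:P (ev f b d)%:P a.
  rewrite /= !deriv_section_x !derivC !horner_section_x !hornerC
    ?horner0 !mulr0 !addr0.
  by apply=> t; rewrite !horner_section_x !hornerC Phi0.
have Eb : D o2 * ev f^`() b c + D o3 * ev f^`() b d = 0.
  have := @mderiv_sum4_eq0 Phi (ev f a c)%:P (ev f a d)%:P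
    (section_x f c) (section_x f d) b.
  rewrite /= !deriv_section_x !derivC !horner_section_x !hornerC
    ?horner0 !mulr0 !add0r.
  by apply=> t; rewrite !horner_section_x !hornerC Phi0.
have Ec : D o0 * ev (deriv_y f) a c + D o2 * ev (deriv_y f) b c = 0.
  have := @mderiv_sum4_eq0 Phi f.[a%:P] (ev f a d)%:P f.[b%:P] (ev f b d)%:P c.
  rewrite /= !deriv_section_y !derivC !hornerC
    ?horner0 !mulr0 !addr0.
  by apply=> t; rewrite !hornerC Phi0.
have Ed : D o1 * ev (deriv_y f) a d + D o3 * ev (deriv_y f) b d = 0.
  have := @mderiv_sum4_eq0 Phi (ev f a c)%:P f.[a%:P] (ev f b c)%:P f.[b%:P] d.
  rewrite /= !deriv_section_y !derivC !hornerC
    ?horner0 !mulr0 !addr0 !add0r.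
  by apply=> t; rewrite !hornerC Phi0.
by elim/ord4_ind: i; case: (kernel_mul_det Ea Eb Ec Ed).
Qed.

(** Induction on the degree of the relation. If some partial derivative of [Phi] is nonzero at a
    rectangle, its product with the Jacobian still vanishes, so the Jacobian does. Otherwise any
    nonzero partial derivative is a smaller relation, and if there is none [Phi] is a nonzero
    constant, which is absurd. *)
Lemma jacobian_eq0 (Phi : {mpoly k[4]}) f : Phi != 0 ->
  (forall a b c d, Phi.@[rect f a b c d] = 0) ->
  forall a b c d, jacobian f a b c d = 0.
Proof.
have [n] := ubnP (msize Phi); elim: n => // n IH in Phi *.
rewrite ltnS => le_n Phin0 Phi0.
case: (classic (exists i a b c d, Phi^`M(i).@[rect f a b c d] != 0)) => [[i nv]|van].
  apply: (polyfun4_mul_eq0 natk (polyfun4_rect Phi^`M(i) f)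
    (polyfun4_jacobian f)) => //.
  exact: mderiv_rect_jacobian.
have {}van i a b c d : Phi^`M(i).@[rect f a b c d] = 0.
  by apply/eqP/negPn/negP => nv; apply: van; exists i, a, b, c, d.
case: (classic (exists i, Phi^`M(i) != 0)) => [[i Dn0]|D0].
  by apply: IH (van i) => //; apply: leq_trans (msize_mderiv_lt Dn0) le_n.
have [i|z E] := mderiv_eq0_const natk (Phi := Phi).
  by apply/eqP/negPn/negP => Dn0; apply: D0; exists i.
move: (Phi0 0 0 0 0) Phin0; rewrite E mevalC => ->.
by rewrite mpolyC0 eqxx.
Qed.

End Rectangles.

(** Some closed set contains [S] but misses a point [v]; one of its equations is nonzero at [v],
    hence a nonzero polynomial, and vanishes on [S]. *)
Lemma not_dense_relation (k : fieldType) n (S : n.-tuple k -> Prop) :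
  ~ zariski_dense S ->
  exists2 Phi : {mpoly k[n]}, Phi != 0 & forall w, S w -> Phi.@[tnth w] = 0.
Proof.
move=> /not_all_ex_not[v] /not_all_ex_not[Z ncl].
have [[I ZI] ncl'] := imply_to_and _ _ ncl; have [SZ nZv] := imply_to_and _ _ ncl'.
have /not_all_ex_not[p np] : ~ zero_locus I v by move/ZI.
have [Ip pv] := imply_to_and _ _ np.
exists p; first by apply/eqP => p0; apply: pv; rewrite p0 meval0.
by move=> w /SZ/ZI; apply.
Qed.

Definition bipoly (k : fieldType) (P : {mpoly k[2]}) : {poly {poly k}} :=
  mmap (polyC \o polyC) (tnth [tuple 'X; 'X%:P]) P.

Lemma horner2_bipoly (k : fieldType) (P : {mpoly k[2]}) x y :
  (bipoly P).[x%:P].[y] = eval2 P x y.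
Proof.
rewrite /eval2 mevalE /bipoly /mmap !horner_sum; apply: eq_bigr => m _.
rewrite /mmap1 !big_ord_recl !big_ord0 !(tnth_nth 0) /=.
by rewrite !hornerE /= ?(hornerE, horner_exp).
Qed.

(** * Separation of variables in the Jacobian identity *)

Section Separation.

Variable k : fieldType.
Hypothesis natk : forall n, n.+1%:R != 0 :> k.

Lemma jacobian_eq0_separation (f : {poly {poly k}}) :
  f^`() != 0 -> deriv_y f != 0 -> (forall a b c d, jacobian f a b c d = 0) ->
  exists a b c d : {poly k},
    [/\ a != 0, b != 0, c != 0 & d != 0] /\
    map_poly polyC a * d%:P * f^`() = map_poly polyC b * c%:P * deriv_y f.
Proof.
move=> fxn0 fyn0 J0.
have [x0 [y0]] : exists x0 y0, (f^`() * deriv_y f).[x0%:P].[y0] != 0.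
  apply: NNPP => no; have /eqP : f^`() * deriv_y f = 0.
    apply: (horner2_eq0 natk) => x y; apply/eqP/negPn/negP => nz.
    by apply: no; exists x, y.
  by rewrite mulf_eq0 (negPf fxn0) (negPf fyn0).
rewrite !hornerM mulf_eq0 negb_or => /andP[].
set u := _.[_].[_]; set v := _.[_].[_] => un0 vn0.
have neq0_horner (p : {poly k}) x : p.[x] != 0 -> p != 0.
  by apply: contraNneq => ->; rewrite horner0.
(* These are the factors of the Jacobian at (x, x0, y, y0), sorted by variable, with the constants
   [u] and [v] absorbed into the two factors in y. None is zero, as both partials are nonzero at
   (x0, y0). *)
exists (section_x (deriv_y f) y0), (section_x f^`() y0),
  (v *: f^`().[x0%:P]), (u *: (deriv_y f).[x0%:P]); split.
  split; rewrite ?scale_poly_eq0 ?negb_or ?un0 ?vn0 /=;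
    [apply: (neq0_horner _ x0) | apply: (neq0_horner _ x0)
    | apply: (neq0_horner _ y0) | apply: (neq0_horner _ y0)];
    by rewrite ?horner_section_x.
apply/eqP; rewrite -subr_eq0; apply/eqP/(horner2_eq0 natk) => x y.
rewrite hornerD hornerN !hornerM !hornerC hornerD hornerN !hornerM.
rewrite !horner2_liftX !horner_section_x !hornerZ -[RHS](J0 x x0 y y0) /jacobian.
by rewrite -/u -/v; ring.
Qed.

End Separation.

Theorem theorem7p1 (k : closedFieldType) (char0 : [pchar k] =i pred0)
    (P : {mpoly k[2]})
    (not_dense : ~ zariski_dense (rectangle_values P)) :
  (exists Q F G : {poly k},
     forall x y : k, eval2 P x y = Q.[F.[x] + G.[y]]) \/
  (exists Q F G : {poly k},
     forall x y : k, eval2 P x y = Q.[F.[x] * G.[y]]).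
Proof.
have natk n : n.+1%:R != 0 :> k by move/pcharf0P: char0 => ->.
have [Phi Phin0 Phi0] := not_dense_relation not_dense.
pose f := bipoly P; have fE x y : eval2 P x y = f.[x%:P].[y].
  by rewrite horner2_bipoly.
(* If a partial derivative vanishes identically, [P] depends on one variable only and is additive
   with [Q] the identity. *)
have [fx0|fxn0] := eqVneq f^`() 0.
  left; exists 'X, 0, f`_0 => x y; rewrite fE hornerX horner0 add0r.
  by rewrite (deriv_eq0_char0 (natr_poly_neq0 natk) fx0) coefC !hornerC.
have [fy0|fyn0] := eqVneq (deriv_y f) 0.
  left; exists 'X, (section_x f 0), 0 => x y.
  rewrite fE hornerX horner0 addr0 horner_section_x.
  have /(deriv_eq0_char0 natk) -> : (f.[x%:P])^`() = 0.
    by rewrite deriv_section_y fy0 horner0.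
  by rewrite !hornerC.
have J0 : forall a b c d, jacobian f a b c d = 0.
  apply: (jacobian_eq0 natk Phin0) => a b c d; apply: Phi0.
  by exists a, b, c, d; rewrite !fE.
have [a [b [c [d [[an0 bn0 cn0 dn0] E]]]]] :=
  jacobian_eq0_separation natk fxn0 fyn0 J0.
by case: (first_integral_structure natk an0 bn0 cn0 dn0 fxn0 E) => -[Q [F [G QE]]];
  [left|right]; exists Q, F, G => x y; rewrite fE.
Qed.
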